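(* There do not exist three distinct positive integers $a,b,c$ such that each of the seven numbers \[ a+1,\quad b+1,\quad c+1,\quad ab+1,\quad ac+1,\quad bc+1,\quad abc+1 \] is a perfect square.
   Context: A positive integer is called a perfect square if it is the square of an integer. *)

(* Defs.v *)
From Stdlib Require Import ZArith.
Open Scope Z_scope.

Definition perfect_square (n : Z) : Prop :=
  0 < n /\ exists r : Z, n = r ^ 2.

(* Main.v *)
Require Import Defs.
From Stdlib Require Import ZArith Lia.
Open Scope Z_scope.

(** For a Diophantine triple [{A, B, C}] (pairwise products plus one are the
    squares [r^2], [s^2], [t^2]) the integer [A + B + C + 2ABC - 2rst] is the
    smaller of the two regular extensions of the triple.  If [a < b < c] were a
    counterexample, both [{a, b, c}] and [{1, ab, c}] would be such triples, and
    comparing sizes shows that their smaller extensions differ by a number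
    strictly between 0 and 1 as soon as [c > ab + 1].  The latter bound follows
    from the gap principle for [{a, b, c}] and [{1, b, c}]. *)

Lemma perfect_square_pos_root (n : Z) :
  perfect_square n -> exists r : Z, 0 < r /\ r * r = n.
Proof.
  intros [Hn [r Hr]]. exists (Z.abs r). nia.
Qed.

Lemma square_lt_inv (m n : Z) : 0 <= n -> m * m < n * n -> m < n.
Proof. nia. Qed.

(** Only [n = 1] has to be excluded, and 2 is not a square. *)
Lemma succ_square_gt_1 (n r : Z) : 0 < n -> 0 < r -> r * r = n + 1 -> 1 < n.
Proof.
  intros Hn Hr E. destruct (Z.le_gt_cases r 1); nia.
Qed.

(** The smaller and larger regular extensions [e] and [e'] satisfy
    [e * e' = (C - A - B)^2 - 4 * r^2]. If [e = 0], this determines [C]; if [e >= 1], then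
    [4 * A * B * C < e' <= e * e' < C^2]. *)
Lemma diophantine_triple_gap (A B C r s t : Z) :
  0 < A -> A < B -> B < C -> 0 < r -> 0 < s -> 0 < t ->
  r * r = A * B + 1 -> s * s = A * C + 1 -> t * t = B * C + 1 ->
  C = A + B + 2 * r \/ 4 * A * B < C.
Proof.
  intros HA HAB HBC Hr Hs Ht Er Es Et.
  set (e := A + B + C + 2 * A * B * C - 2 * (r * s * t)).
  set (e' := A + B + C + 2 * A * B * C + 2 * (r * s * t)).
  (* As [B >= 2], the integer [e] cannot be negative once [B * e + 1] is a square. *)
  assert (HBe : B * e + 1 = (B * s - r * t) * (B * s - r * t)).
  { transitivity (B * B * (s * s) + (r * r) * (t * t) - 2 * B * (r * s * t));
      [ rewrite Er, Es, Et; unfold e; ring | ring ]. }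
  assert (Hee : e * e' = (C - A - B) * (C - A - B) - 4 * (r * r)).
  { transitivity ((A + B + C + 2 * A * B * C) * (A + B + C + 2 * A * B * C)
                  - 4 * ((r * r) * (s * s) * (t * t)));
      [ unfold e, e'; ring | rewrite Er, Es, Et; ring ]. }
  assert (He : 0 <= e).
  { pose proof (Z.square_nonneg (B * s - r * t)) as Hsq.
    rewrite <- HBe in Hsq. clearbody e. clear - Hsq HA HAB. nia. }
  assert (Hrst : 0 < r * s * t) by (repeat apply Z.mul_pos_pos; assumption).
  destruct (Z.eq_dec e 0) as [He0 | He0].
  - left.
    (* This discards the other root [C = A + B - 2 * r], which would lie below [B]. *)
    assert (HrA : A < r) by (apply square_lt_inv; clear - Er HA HAB Hr; nia).
    assert (Hf : (C - A - B - 2 * r) * (C - A - B + 2 * r) = 0)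
      by (rewrite He0 in Hee; lia).
    apply Z.mul_eq_0 in Hf. lia.
  - right.
    assert (Hpos : 0 < A * B * C) by (repeat apply Z.mul_pos_pos; lia).
    assert (Hlt : A * B * C <= r * s * t).
    { apply Z.lt_le_incl, square_lt_inv; [lia |].
      replace (r * s * t * (r * s * t)) with ((r * r) * (s * s) * (t * t)) by ring.
      rewrite Er, Es, Et.
      assert (0 < A * B /\ 0 < A * C /\ 0 < B * C) as (H1 & H2 & H3)
        by (repeat split; apply Z.mul_pos_pos; lia).
      assert (0 < (A * B) * (A * C) /\ 0 < (A * B) * (B * C)
              /\ 0 < (A * C) * (B * C)) as (H4 & H5 & H6)
        by (repeat split; apply Z.mul_pos_pos; lia).
      clear - Hpos H1 H2 H3 H4 H5 H6. lia. }
    assert (He' : 4 * (A * B * C) < e') by (unfold e'; lia).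
    assert (Hle : e' <= e * e')
      by (clearbody e e'; clear - He He0 He' Hpos; nia).
    assert (Hsq : (C - A - B) * (C - A - B) <= C * C) by (clear - HA HAB HBC; nia).
    assert (HC : 4 * A * B * C < C * C)
      by (pose proof (Z.square_nonneg r); lia).
    apply <- Z.mul_lt_mono_pos_r in HC; lia.
Qed.

Lemma no_ordered_triple (a b c q x t y z w : Z) :
  1 < a -> a < b -> b < c ->
  0 < q -> 0 < x -> 0 < t -> 0 < y -> 0 < z -> 0 < w ->
  q * q = b + 1 -> x * x = c + 1 ->
  t * t = a * b + 1 -> y * y = a * c + 1 -> z * z = b * c + 1 ->
  w * w = a * b * c + 1 -> False.
Proof.
  intros Ha Hab Hbc Hq Hx Ht Hy Hz Hw Eq Ex Et Ey Ez Ew.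
  assert (Hc : a * b + 1 < c).
  { destruct (diophantine_triple_gap a b c t y z) as [H1 | H1]; try lia.
    - destruct (diophantine_triple_gap 1 b c q x z) as [H2 | H2]; try lia.
      + assert (q < t) by (apply square_lt_inv; clear - Eq Et Ha Hab Ht; nia). lia.
      + assert (t < b + 1) by (apply square_lt_inv; clear - Et Ha Hab; nia). lia. }
  (* [M] is [(1 + a * b) - (a + b)]. The root products of [{1, a * b, c}] and [{a, b, c}] are
     [t * x * w] and [t * y * z], so [t * k] is their difference. *)
  set (M := (a - 1) * (b - 1)).
  set (k := x * w - y * z).
  set (S := x * w + y * z).
  assert (HM : 0 < M) by (unfold M; clear - Ha Hab; nia).
  assert (HMab : M < a * b) by (unfold M; lia).
  assert (Hxw2 : (x * w) * (x * w) = (c + 1) * (a * b * c + 1))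
    by (rewrite <- Ex, <- Ew; ring).
  assert (Hyz2 : (y * z) * (y * z) = (a * c + 1) * (b * c + 1))
    by (rewrite <- Ey, <- Ez; ring).
  assert (Htc2 : (t * c) * (t * c) = (a * b + 1) * (c * c))
    by (rewrite <- Et; ring).
  assert (HkS : k * S = M * c).
  { transitivity ((x * w) * (x * w) - (y * z) * (y * z)); [unfold k, S; ring |].
    rewrite Hxw2, Hyz2. unfold M. ring. }
  assert (Hxw : 0 < x * w) by (apply Z.mul_pos_pos; lia).
  assert (Hyz : 0 < y * z) by (apply Z.mul_pos_pos; lia).
  assert (Htc : 0 < t * c) by (apply Z.mul_pos_pos; lia).
  (* After squaring, this is [c * (a * b + 1) + 1 < c^2], where the bound [Hc] enters. *)
  assert (H1 : x * w < t * c).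
  { apply square_lt_inv; [lia |]. rewrite Hxw2, Htc2.
    clear - Hc Ha Hab Hbc. nia. }
  assert (H2 : y * z < x * w).
  { apply square_lt_inv; [lia |]. rewrite Hxw2, Hyz2. unfold M in HM.
    clear - HM Ha Hab Hbc. nia. }
  (* After squaring, it suffices that [(a * b + 1) * M^2 <= a * b * (M + 1)^2], which holds by
     [M < a * b], and that [a * b * c^2 < (a * c + 1) * (b * c + 1)]. *)
  assert (H3 : t * c * M < (M + 1) * (y * z)).
  { apply square_lt_inv; [apply Z.mul_nonneg_nonneg; lia |].
    replace (t * c * M * (t * c * M)) with ((t * c) * (t * c) * (M * M)) by ring.
    replace ((M + 1) * (y * z) * ((M + 1) * (y * z)))
      with ((M + 1) * (M + 1) * ((y * z) * (y * z))) by ring.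
    rewrite Htc2, Hyz2.
    assert (H : (a * b + 1) * (M * M) <= a * b * ((M + 1) * (M + 1)))
      by (clearbody M; clear - HM HMab; nia).
    apply Z.le_lt_trans with ((a * b * ((M + 1) * (M + 1))) * (c * c)).
    { replace ((a * b + 1) * (c * c) * (M * M))
        with ((a * b + 1) * (M * M) * (c * c)) by ring.
      apply Z.mul_le_mono_nonneg_r; [apply Z.square_nonneg | exact H]. }
    replace (a * b * ((M + 1) * (M + 1)) * (c * c))
      with ((M + 1) * (M + 1) * (a * b * (c * c))) by ring.
    apply Z.mul_lt_mono_pos_l.
    - apply Z.mul_pos_pos; lia.
    - clear - Ha Hab Hbc. nia. }
  (* [2 * t * k - M] is the difference of the two smaller regular extensions. *)
  assert (HdS : (2 * t * k - M) * S = M * (2 * (t * c) - S)).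
  { transitivity (2 * t * (k * S) - M * S); [ring | rewrite HkS; ring]. }
  assert (HS : 0 < S) by (unfold S; lia).
  assert (Hlow : 0 < (2 * t * k - M) * S)
    by (rewrite HdS; apply Z.mul_pos_pos; unfold S; lia).
  (* Equivalent to [2 * t * c * M < (M + 1) * S], which follows from [H3] and [2 * y * z < S]. *)
  assert (Hup : (2 * t * k - M) * S < 1 * S).
  { rewrite HdS. unfold S.
    assert (H4 : M * (y * z) < M * (x * w)) by (apply Z.mul_lt_mono_pos_l; assumption).
    clearbody M. clear - H2 H3 H4. lia. }
  apply <- (Z.mul_lt_mono_pos_r S) in Hup; [| exact HS].
  apply -> Z.mul_pos_cancel_r in Hlow; [| exact HS].
  clear - Hup Hlow. lia.
Qed.

Theorem theorem2 :
  ~ exists a b c : Z,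
      (0 < a /\ 0 < b /\ 0 < c) /\
      (a <> b /\ a <> c /\ b <> c) /\
      perfect_square (a + 1) /\
      perfect_square (b + 1) /\
      perfect_square (c + 1) /\
      perfect_square (a * b + 1) /\
      perfect_square (a * c + 1) /\
      perfect_square (b * c + 1) /\
      perfect_square (a * b * c + 1).
Proof.
  intros (a & b & c & (Ha & Hb & Hc) & (Hab & Hac & Hbc) &
          Pa & Pb & Pc & Pab & Pac & Pbc & Pabc).
  apply perfect_square_pos_root in Pa as (p & Hp & Ep).
  apply perfect_square_pos_root in Pb as (q & Hq & Eq).
  apply perfect_square_pos_root in Pc as (x & Hx & Ex).
  apply perfect_square_pos_root in Pab as (t & Ht & Et).
  apply perfect_square_pos_root in Pac as (y & Hy & Ey).
  apply perfect_square_pos_root in Pbc as (z & Hz & Ez).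
  apply perfect_square_pos_root in Pabc as (w & Hw & Ew).
  assert (Ha1 : 1 < a) by (apply (succ_square_gt_1 a p); assumption).
  assert (Hb1 : 1 < b) by (apply (succ_square_gt_1 b q); assumption).
  assert (Hc1 : 1 < c) by (apply (succ_square_gt_1 c x); assumption).
  (* By symmetry, each of the six orderings is the ordered case with the roots permuted. *)
  destruct (Z.lt_total a b) as [L1 | [L1 | L1]]; [| contradiction |];
  destruct (Z.lt_total a c) as [L2 | [L2 | L2]]; try contradiction;
  destruct (Z.lt_total b c) as [L3 | [L3 | L3]]; try contradiction; try lia.
  - apply (no_ordered_triple a b c q x t y z w); lia.
  - apply (no_ordered_triple a c b x q y t z w); lia.
  - apply (no_ordered_triple c a b p q y z t w); lia.
  - apply (no_ordered_triple b a c p x t z y w); lia.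
  - apply (no_ordered_triple b c a x p z t y w); lia.
  - apply (no_ordered_triple c b a q p z y t w); lia.
Qed.
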